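(* 1. The number of points of $\mathrm{PG}(8,q)$ fixed by $\sigma$ is $\mathrm g(q^2+q+1)$. 2. Each $\mathbb S_{\mathrm I}$-plane contains exactly $\mathrm g$ fixed points. 3. The fixed points form exactly $\mathrm g$ ptwise-fixed planes, and these planes are $\mathcal P_{2,q}$-ruling planes.
   Context: Let $q>2$ be a prime power and $\mathrm{g}=\gcd(3,q-1)$. Let $\phi$ be a collineation of $\mathrm{PG}(2,q^3)$ of order 3 fixing pointwise an $\mathbb F_q$-subplane $\mathcal P_{2,q}$; points of $\mathcal P_{2,q}$ are the Type-I-points. Bose representation: identifying $\mathbb F_{q^3}^3$ with $\mathbb F_q^9$, each point $\bar P$ of $\mathrm{PG}(2,q^3)$ corresponds to a plane $[\![P]\!]$ of $\mathrm{PG}(8,q)$ (an $\mathbb S$-plane; these form a regular 2-spread). $\mathbb S_{\mathrm I}$-planes are the $\mathbb S$-planes $[\![P]\!]$ with $\bar P\in\mathcal P_{2,q}$; they form one system of ruling planes of a Segre variety $\mathcal S_{2;2}$, and the planes of the other ruling system are called $\mathcal P_{2,q}$-ruling planes. The ($\mathbb F_q$-linear) semilinear map defining $\phi$ induces a projectivity $\sigma$ of $\mathrm{PG}(8,q)$ of order 3 with $[\![P]\!]^\sigma=[\![P^\phi]\!]$. A fixed point is a point fixed by $\sigma$; a ptwise-fixed plane is a plane every point of which is fixed by $\sigma$.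
   Formalization: The semilinear map defining φ, determined only up to a scalar, is taken to have order 3 itself; without this, for q ≡ 1 mod 3, a multiple by a scalar whose norm is not a cube in F_q still defines φ but gives a σ of order 3 with no fixed points. *)

(* Defs.v *)
From HB Require Import structures.
From mathcomp Require Import all_boot all_order all_algebra all_field.

Set Implicit Arguments.
Unset Strict Implicit.
Unset Printing Implicit Defensive.

Import GRing.Theory.
Local Open Scope ring_scope.

(* Subspaces of projective dimension k of PG(V): points are k = 0, lines are
   k = 1 and planes are k = 2. *)
Notation PGsub V k := {U : {vspace V} | \dim U == k.+1}.

(* {vspace V} carries no finType structure, even over a finite field. *)
Definition has_card (T : eqType) (P : T -> Prop) (n : nat) : Prop :=
  exists s : seq T, [/\ uniq s, (forall x, x \in s <-> P x) & size s = n].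

Definition order3 (T : Type) (h : T -> T) : Prop :=
  (forall x, h (h (h x)) = x) /\ (exists x, h x <> x).

Definition collineation (K : fieldType) (V : vectType K)
    (phi : PGsub V 0 -> PGsub V 0) : Prop :=
  bijective phi /\
  forall l : PGsub V 1, exists l' : PGsub V 1, forall P : PGsub V 0,
    (val P <= val l)%VS = (val (phi P) <= val l')%VS.

Definition semilinear_map (K : fieldType) (V : lmodType K) (f : V -> V) : Prop :=
  exists tau : {rmorphism K -> K},
    forall (a : K) (u v : V), f (a *: u + v) = tau a *: f u + f v.

(* f is determined by phi only up to a scalar of K. "The" semilinear map of a
   collineation of order 3 is normalised by requiring f itself to have order 3:
   when q = 1 mod 3, scaling f by an element whose norm is not a cube in F_q
   still defines phi but yields a projectivity of PG(8, q) with no fixed point. *)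
Definition defines (K : fieldType) (V : vectType K) (f : V -> V)
    (phi : PGsub V 0 -> PGsub V 0) : Prop :=
  forall (P : PGsub V 0) (v : V), v \in val P -> f v \in val (phi P).

Section Bose.

Variables (F : finFieldType) (L : fieldExtType F).

(* The F-subplanes of PG(2, L) are the images of PG(2, F) under PGL(3, L). *)
Definition subplane (S : PGsub 'rV[L]_3 0 -> Prop) : Prop :=
  exists2 B : 'M[L]_3, B \in unitmx &
    forall P : PGsub 'rV[L]_3 0, S P <->
      exists2 c : 'rV[F]_3, c != 0 & val P = <[map_mx (in_alg L) c *m B]>%VS.

Definition identification (iota : 'rV[F]_9 -> 'rV[L]_3) : Prop :=
  bijective iota /\
  forall (c : F) (u v : 'rV[F]_9), iota (c *: u + v) = c%:A *: iota u + iota v.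

Variable iota : 'rV[F]_9 -> 'rV[L]_3.

(* [[P]]; when iota is an identification the spanning set is already a subspace,
   so that v \in bose P iff iota v \in val P. *)
Definition bose (P : PGsub 'rV[L]_3 0) : {vspace 'rV[F]_9} :=
  <<enum [pred v : 'rV[F]_9 | iota v \in val P]>>%VS.

Definition induces (f : 'rV[L]_3 -> 'rV[L]_3)
    (sigma : PGsub 'rV[F]_9 0 -> PGsub 'rV[F]_9 0) : Prop :=
  forall (Q : PGsub 'rV[F]_9 0) (v w : 'rV[F]_9),
    v \in val Q -> iota w = f (iota v) -> w \in val (sigma Q).

(* F^3 (x) F^3 is realised as 'M[F]_3, with x (x) y = x^T *m y. A linear
   bijection T from it onto F^9 gives the Segre variety S_{2;2} whose points are
   the <T (x (x) y)>; its two systems of ruling planes are obtained by fixing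
   x, respectively y. *)
Definition ruling1 (T : {linear 'M[F]_3 -> 'rV[F]_9}) (x : 'rV[F]_3) :
    {vspace 'rV[F]_9} :=
  limg (linfun (fun y : 'rV[F]_3 => T (x^T *m y))).

Definition ruling2 (T : {linear 'M[F]_3 -> 'rV[F]_9}) (y : 'rV[F]_3) :
    {vspace 'rV[F]_9} :=
  limg (linfun (fun x : 'rV[F]_3 => T (x^T *m y))).

Definition subplane_ruling_plane (S : PGsub 'rV[L]_3 0 -> Prop)
    (U : {vspace 'rV[F]_9}) : Prop :=
  exists T : {linear 'M[F]_3 -> 'rV[F]_9},
    [/\ bijective T,
        (forall W : {vspace 'rV[F]_9},
           (exists2 x, x != 0 & W = ruling1 T x) <->
           (exists2 P, S P & W = bose P))
      & exists2 y, y != 0 & U = ruling2 T y].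

End Bose.

Definition ptwise_fixed (K : fieldType) (V : vectType K)
    (sigma : PGsub V 0 -> PGsub V 0) (U : PGsub V 2) : Prop :=
  forall Q : PGsub V 0, (val Q <= val U)%VS -> sigma Q = Q.

(* Main.v *)
(* In coordinates with respect to the matrix [B] of the subplane, fixing the
   subplane pointwise forces [f (v B) = l * tau(v) B] for a nontrivial
   automorphism [tau] of [L] over [F], and [f^3 = 1] gives [tau^3 = 1] and
   [N(l) = 1]. A point of PG(8, q) is fixed by [sigma] iff it is spanned by an
   eigenvector [f v = a v] with [a] in [F], and then [a^3 = 1]; there are
   gcd(3, q - 1) such [a]. By Hilbert 90 there is [rho] in [L^*] with
   [l * tau(rho) = a * rho], so the [a]-eigenspace is [rho * F^3 B]. In the
   tensor model [x (x) y |-> y * (x B)] of [L^3], with [y] in [L = F^3], this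
   is the ruling plane obtained by fixing [y = rho]. *)
Require Import Defs.
From HB Require Import structures.
From mathcomp Require Import all_boot all_order all_algebra all_field.
From mathcomp Require Import all_fingroup all_solvable.
From mathcomp Require Import ring.

Set Implicit Arguments.
Unset Strict Implicit.
Unset Printing Implicit Defensive.

Import GRing.Theory.
Local Open Scope ring_scope.

(** * Cube roots of unity in a finite field *)

Lemma cube_roots_of_unity (F : finFieldType) :
  exists s : seq F, [/\ uniq s, forall a, (a \in s) = (a ^+ 3 == 1)
    & size s = gcdn 3 (#|F| - 1)].
Proof.
have cardU : #|[set: {unit F}]| = (#|F| - 1)%N by rewrite card_finField_unit subn1.
(* A root [a] other than 1 has order 3 in the unit group, so Lagrange makes 3 divide the order of
   that group and the gcd equals 3. *)
case: (pickP [pred a : F | (a ^+ 3 == 1) && (a != 1)]) => [a /andP[/eqP a3 a1]|no].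
  have aU : a \is a GRing.unit.
    by rewrite unitfE; apply: contra_eq_neq a3 => ->; rewrite expr0n /= eq_sym oner_eq0.
  have o3 : #[FinRing.unit F aU]%g = 3%N.
    by apply: nt_prime_order => //; apply: val_inj; rewrite FinRing.val_unitX.
  have div3 : (3 %| #|F| - 1)%N by rewrite -cardU -o3 order_dvdG ?inE.
  (* Reducing by this relation turns the product of the factors at [1], [a] and [a ^+ 2] into
     [x ^+ 3 - 1]. *)
  have a2 : a ^+ 2 = - a - 1.
    have /eqP := subrr (a ^+ 3); rewrite {2}a3.
    have -> : a ^+ 3 - 1 = (a - 1) * (a ^+ 2 + a + 1) by ring.
    rewrite mulf_eq0 subr_eq0 (negPf a1) /= => /eqP e.
    by apply/eqP; rewrite -subr_eq0 -e; apply/eqP; ring.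
  have a0 : a != 0 by rewrite -unitfE.
  exists [:: 1; a; a ^+ 2]; split.
  - rewrite /= !inE negb_or eq_sym a1 /= andbT; apply/andP; split.
      apply: contraNneq a1 => e; have := a3; rewrite exprS -e mulr1 => ->//.
    by rewrite -{1}[a]mulr1 expr2 (inj_eq (mulfI a0)) eq_sym.
  - move=> x; rewrite !inE -(subr_eq0 (x ^+ 3)).
    have -> : x ^+ 3 - 1 = (x - 1) * ((x - a) * (x - a ^+ 2)).
      have e1 : a * a ^+ 2 = 1 by rewrite -exprS.
      have -> : (x - 1) * ((x - a) * (x - a ^+ 2)) = x ^+ 3 - x ^+ 2 * (a ^+ 2 + a + 1)
         + x * (a ^+ 2 + a + a * a ^+ 2) - a * a ^+ 2 by ring.
      by rewrite e1 a2; ring.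
    by rewrite !mulf_eq0 !subr_eq0.
  - by rewrite /= (gcdn_idPl div3).
exists [:: 1]; split=> //.
  move=> x; rewrite inE; apply/eqP/eqP => [->|x3]; first by rewrite expr1n.
  by have /negbT := no x; rewrite /= x3 eqxx /= negbK => /eqP.
(* If 3 divided the order of the unit group, Cauchy's theorem would supply a unit of order 3, hence
   a root other than 1. *)
apply/eqP; rewrite eq_sym /= -/(coprime _ _) prime_coprime // -cardU.
apply/negP => /Cauchy [] // u _ o3.
have /negP[] := negbT (no (val u)); apply/andP; split.
  by rewrite -FinRing.val_unitX -o3 expg_order.
apply/eqP => u1; have : u = 1%g by apply: val_inj.
by move=> u1'; rewrite u1' order1 in o3.
Qed.

(** * Automorphisms of a cubic extension: fixed field and Hilbert 90 *)

Section Automorphism.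

Variables (F : fieldType) (L : fieldExtType F) (tau : {rmorphism L -> L}).

(** The degree of [F(x)] divides the prime 3. If it is 1, [x] lies in [F]. If it is 3, every element
    is a polynomial in [x] over [F], so [tau] would be the identity. *)
Lemma fixed_in_alg (x : L) : \dim {:L} = 3%N ->
  (forall a : F, tau a%:A = a%:A) -> (exists y, tau y != y) ->
  tau x = x -> exists k : F, x = k%:A.
Proof.
move=> dimL tauF [y tau_y] tx.
have := field_dimS (subvf <<1; x>>%AS); rewrite dimL.
rewrite (dvdn_divisors _ (isT : 0 < 3)%N) !inE => /orP[] /eqP d.
  have e : 1%AS = <<1; x>>%AS :> {vspace L}.
    by apply/eqP; rewrite eqEdim subv_adjoin /= d dimv1.
  have : x \in (1%AS : {vspace L}) by rewrite e memv_adjoin.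
  by case/vlineP => k ->; exists k.
have e : <<1; x>>%AS = fullv :> {vspace L} by apply/eqP; rewrite eqEdim subvf d dimL.
have /Fadjoin_polyP[p /polyOverP p1 yE] : y \in <<1%AS; x>>%VS by rewrite e memvf.
case/eqP: tau_y; rewrite yE -horner_map tx; congr _.[_].
apply/polyP => i; rewrite coef_map.
by have /vlineP[k ->] := p1 i; rewrite /= tauF.
Qed.

(* Dedekind's independence of [1], [tau], [tau^2] makes the resolvent of some
   element nonzero. *)
Lemma hilbert90_order3 (c : L) :
  (forall x, tau (tau (tau x)) = x) -> (exists y, tau y != y) ->
  c * tau c * tau (tau c) = 1 -> exists2 x, x != 0 & c * tau x = x.
Proof.
move=> tau3 [y tau_y] Nc.
(* [R t] sums the orbit of [t] under the operator [x |-> c * tau x], whose cube is multiplication by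
   the norm of [c], that is, the identity; hence the operator fixes [R t]. *)
pose R t := t + c * tau t + c * tau c * tau (tau t).
have RE t : c * tau (R t) = R t.
  rewrite /R !rmorphD !rmorphM /= tau3.
  have -> : c * (tau t + tau c * tau (tau t) + tau c * tau (tau c) * t) =
     c * tau t + c * tau c * tau (tau t) + (c * tau c * tau (tau c)) * t by ring.
  by rewrite Nc; ring.
case: (eqVneq (R 1) 0) => [R1|]; last by exists (R 1).
case: (eqVneq (R y) 0) => [Ry|]; last by exists (R y).
case: (eqVneq (R (y * y)) 0) => [Ryy|]; last by exists (R (y * y)).
(* The polynomial with roots [y] and [tau y] combines [R 1], [R y] and [R (y * y)] so that only the
   [tau^2] term survives. *)
have : (c * tau c) * ((tau (tau y) - y) * (tau (tau y) - tau y)) = 0.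
  have -> : (c * tau c) * ((tau (tau y) - y) * (tau (tau y) - tau y)) =
     R (y * y) - (y + tau y) * R y + y * tau y * R 1.
    by rewrite /R !rmorphM !rmorph1; ring.
  by rewrite R1 Ry Ryy; ring.
have c0 : c * tau c != 0.
  by apply: contra_eq_neq Nc => ->; rewrite mul0r eq_sym oner_eq0.
move/eqP; rewrite !mulf_eq0 -mulf_eq0 (negPf c0) /= !subr_eq0 => /orP[] /eqP e.
  by case/eqP: tau_y; rewrite -{1}e tau3.
by case/eqP: tau_y; apply: (fmorph_inj tau).
Qed.

End Automorphism.

(** * Normalized homogeneous coordinates for the points of PG(2, q) *)

Section NormalizedTriples.

Variable F : finFieldType.

Let triple (x y z : F) : 'rV[F]_3 := \row_(j < 3) [:: x; y; z]`_j.

Let tripleP (c : 'rV[F]_3) : c = triple (c 0 0) (c 0 1) (c 0 2%:R).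
Proof.
apply/rowP => j; rewrite !mxE.
by case: j => [[|[|[|j]]] //= hj]; congr (c _ _); apply: val_inj.
Qed.

Let triple_inj x y z x' y' z' :
  triple x y z = triple x' y' z' -> [/\ x = x', y = y' & z = z'].
Proof.
move=> h; have e (j : 'I_3) := congr1 (fun c : 'rV_3 => c 0 j) h.
by have := e 0; have := e 1; have := e 2%:R; rewrite !mxE /= => -> -> ->.
Qed.

Let tripleZ k x y z : k *: triple x y z = triple (k * x) (k * y) (k * z).
Proof.
by apply/rowP => j; rewrite !mxE; case: j => [[|[|[|j]]] //= hj].
Qed.

(** Scaling the first nonzero coordinate to 1 leaves the shapes [(1, x, y)], [(0, 1, x)] and
    [(0, 0, 1)], which account for the three terms of the count. *)
Lemma point_representatives :
  exists s : seq 'rV[F]_3, [/\ uniq s, 0 \notin s, size s = (#|F| ^ 2 + #|F| + 1)%N,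
    forall c : 'rV[F]_3, c != 0 -> exists k (d : 'rV[F]_3), [/\ k != 0, d \in s & c = k *: d]
    & forall (c d : 'rV[F]_3) k, c \in s -> d \in s -> c = k *: d -> c = d].
Proof.
pose s1 := [seq triple 1 x y | x <- enum F, y <- enum F].
pose s2 := [seq triple 0 1 x | x <- enum F].
have s1P c : c \in s1 -> exists x y, c = triple 1 x y.
  by case/allpairsP => -[x y] [_ _ ->]; exists x, y.
have s2P c : c \in s2 -> exists x, c = triple 0 1 x by case/mapP => x _ ->; exists x.
have in1 x y : triple 1 x y \in s1 by apply: allpairs_f; rewrite mem_enum.
have in2 x : triple 0 1 x \in s2 by apply: map_f; rewrite mem_enum.
have n10 := oner_neq0 F.
have e0 : 0 = triple 0 0 0 by rewrite (tripleP 0) !mxE.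
have sP c : c \in s1 ++ s2 ++ [:: triple 0 0 1] ->
   [\/ exists x y, c = triple 1 x y, exists x, c = triple 0 1 x | c = triple 0 0 1].
  rewrite !mem_cat inE => /or3P[/s1P|/s2P|/eqP]; first by constructor 1.
    by constructor 2.
  by constructor 3.
exists (s1 ++ s2 ++ [:: triple 0 0 1]); split.
- rewrite cat_uniq; apply/and3P; split.
  + apply: allpairs_uniq; rewrite ?enum_uniq //.
    by move=> [x y] [x' y'] _ _ /= /triple_inj[_ -> ->].
  + apply/hasPn => c; rewrite mem_cat inE => /orP[/s2P[x ->]|/eqP ->];
    by apply/negP => /s1P[u [v /triple_inj[/eqP]]]; rewrite eq_sym (negPf n10).
  + rewrite cat_uniq /= orbF andbT map_inj_uniq ?enum_uniq /=; last first.
      by move=> x y /triple_inj[].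
    by apply/negP => /s2P[u /triple_inj[_ /eqP]]; rewrite eq_sym (negPf n10).
- apply/negP => /sP[[x [y]]|[x]|]; rewrite e0 => /triple_inj[] h1 h2 h3.
  + by rewrite -h1 eqxx in n10.
  + by rewrite -h2 eqxx in n10.
  + by rewrite -h3 eqxx in n10.
- by rewrite !size_cat size_allpairs /s2 size_map addnA mulnn cardT.
- move=> c; rewrite (tripleP c); move: (c 0 0) (c 0 1) (c 0 2%:R) => x y z.
  case: (eqVneq x 0) => [->|x0 _].
    case: (eqVneq y 0) => [->|y0 _].
      case: (eqVneq z 0) => [->|z0 _]; first by rewrite -e0 eqxx.
      exists z, (triple 0 0 1); rewrite !mem_cat inE eqxx !orbT; split=> //.
      by rewrite tripleZ !mulr0 mulr1.
    exists y, (triple 0 1 (z / y)); rewrite !mem_cat in2 !orbT; split=> //.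
    by rewrite tripleZ !mulr0 mulr1 mulrC divfK.
  exists x, (triple 1 (y / x) (z / x)); rewrite !mem_cat in1; split=> //.
  by rewrite tripleZ mulr1 ![x * _]mulrC !divfK.
(* For equal shapes the leading 1 forces [k = 1]; for different shapes some coordinate forces
   [1 = 0]. *)
- have abs : 1 = 0 :> F -> False by move/eqP; rewrite (negPf n10).
  move=> c d k /sP[[x [y ->]]|[x ->]|->] /sP[[x' [y' ->]]|[x' ->]|->] //;
    rewrite tripleZ => /triple_inj[]; rewrite ?mulr0 ?mulr1.
  + by move=> <- -> ->; rewrite !mul1r.
  + by move=> /abs.
  + by move=> /abs.
  + by move=> <-; rewrite mul0r => /abs.
  + by move=> _ <- ->; rewrite mul1r.
  + by move=> _ /abs.
  + by move=> <- _; rewrite mul0r => /abs.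
  + by move=> _ <-; rewrite mul0r => /abs.
Qed.

End NormalizedTriples.

(** * Counting subspaces, points and eigenvectors *)

Lemma has_card_PGsub (K : fieldType) (V : vectType K) (k : nat)
    (P : PGsub V k -> Prop) (A : eqType) (s : seq A) (r : A -> {vspace V}) :
  uniq s -> {in s &, injective r} -> {in s, forall a, \dim (r a) = k.+1} ->
  (forall Q, P Q <-> exists2 a, a \in s & val Q = r a) -> has_card P (size s).
Proof.
move=> us r_inj r_dim PE.
(* [insub] drops values of the wrong dimension; by [r_dim] there are none, so the size is
   preserved. *)
exists (pmap insub (map r s)); split.
- by apply: pmap_sub_uniq; rewrite map_inj_in_uniq.
- by move=> Q; rewrite mem_pmap_sub PE; split=> [/mapP|h]; last apply/mapP.
- rewrite size_pmap_sub -(size_map r s); apply/eqP; rewrite -all_count.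
  by apply/allP => _ /mapP[a sa ->]; rewrite r_dim.
Qed.

Lemma PG_pointP (K : fieldType) (V : vectType K) (Q : PGsub V 0) :
  exists2 v, v != 0 & val Q = <[v]>%VS.
Proof.
have dQ := eqP (valP Q); exists (vpick (val Q)).
  by rewrite vpick0 -dimv_eq0 dQ.
apply/esym/eqP; rewrite eqEdim -memvE memv_pick dQ dim_vline.
by rewrite vpick0 -dimv_eq0 dQ.
Qed.

Lemma PG_point_eq (K : fieldType) (V : vectType K) (Q Q' : PGsub V 0) v :
  v != 0 -> v \in val Q -> v \in val Q' -> Q = Q'.
Proof.
move=> v0 vQ vQ'; apply: val_inj.
have line (R : PGsub V 0) : v \in val R -> <[v]>%VS = val R.
  by move=> vR; apply/eqP; rewrite eqEdim -memvE vR (eqP (valP R)) dim_vline v0.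
by rewrite /= -(line _ vQ) -(line _ vQ').
Qed.

Lemma vline_eq (K : fieldType) (V : vectType K) (u v : V) :
  <[u]>%VS = <[v]>%VS -> exists k, u = k *: v.
Proof. by move=> e; apply/vlineP; rewrite -e memv_line. Qed.

(* If [h u = a u], [h w = b w] and [h (u + w) = d (u + w)] with [a != b], then
   [u] and [w] would be proportional. *)
Lemma common_eigenvalue (K : fieldType) (V : lmodType K) (h : {linear V -> V})
    (u w : V) (a b d : K) : u != 0 -> w != 0 ->
  h u = a *: u -> h w = b *: w -> h (u + w) = d *: (u + w) -> a = b.
Proof.
move=> u0 w0 hu hw; rewrite linearD /= hu hw scalerDr => e.
have {}e : (a - d) *: u = (d - b) *: w.
  rewrite !scalerBl; apply/eqP; rewrite subr_eq addrAC eq_sym subr_eq eq_sym.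
  by rewrite e addrC.
(* Applying [h] gives [(a - d) * (a - b) = 0]; if [a = d], the relation [e] itself forces
   [d = b]. *)
have := congr1 h e; rewrite !linearZ /= hu hw [(d - b) *: _]scalerA.
rewrite [_ * b]mulrC -scalerA -e !scalerA => /eqP.
rewrite -subr_eq0 -scalerBl scaler_eq0 (negPf u0) orbF [b * _]mulrC -mulrBr.
rewrite mulf_eq0 !subr_eq0 => /orP[/eqP ad|/eqP //].
move/eqP: e; rewrite ad subrr scale0r eq_sym scaler_eq0 (negPf w0) orbF.
by rewrite subr_eq0 => /eqP.
Qed.

(** * Pure tensors and the two rulings of the Segre variety *)

Section Tensors.

Variables (F : finFieldType) (T : {linear 'M[F]_3 -> 'rV[F]_9}).

(** The same bilinear map is curried in both orders, so that each argument in turn comes last and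
    carries a linear structure. *)
Definition tensor_l (x y : 'rV[F]_3) := T (x^T *m y).
Definition tensor_r (y x : 'rV[F]_3) := T (x^T *m y).

Fact tensor_l_linear x : linear (tensor_l x).
Proof. by move=> k u v; rewrite /tensor_l mulmxDr -scalemxAr linearP. Qed.

Fact tensor_r_linear y : linear (tensor_r y).
Proof. by move=> k u v; rewrite /tensor_r !linearP mulmxDl -scalemxAl linearP. Qed.

HB.instance Definition _ x :=
  GRing.isLinear.Build F 'rV[F]_3 'rV[F]_9 _ (tensor_l x) (tensor_l_linear x).
HB.instance Definition _ y :=
  GRing.isLinear.Build F 'rV[F]_3 'rV[F]_9 _ (tensor_r y) (tensor_r_linear y).

Lemma ruling1P x v : reflect (exists y, v = T (x^T *m y)) (v \in ruling1 T x).
Proof.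
apply: (iffP memv_imgP) => [[y _ ->]|[y ->]]; exists y; rewrite ?memvf //.
  exact: (lfunE (tensor_l x)).
exact/esym/(lfunE (tensor_l x)).
Qed.

Lemma ruling2P y v : reflect (exists x, v = T (x^T *m y)) (v \in ruling2 T y).
Proof.
apply: (iffP memv_imgP) => [[x _ ->]|[x ->]]; exists x; rewrite ?memvf //.
  exact: (lfunE (tensor_r y)).
exact/esym/(lfunE (tensor_r y)).
Qed.

Lemma tensorE (x y : 'rV[F]_3) i j : (x^T *m y) i j = x 0 i * y 0 j.
Proof. by rewrite !mxE big_ord1 mxE. Qed.

Lemma row_neq0 (R : nzRingType) n (y : 'rV[R]_n) : y != 0 -> exists j, y 0 j != 0.
Proof.
move=> y0; apply/existsP; apply: contraNT y0 => /existsPn h.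
by apply/eqP/rowP => j; rewrite mxE; apply/eqP; have := h j; rewrite negbK.
Qed.

Lemma tensor_eq (x x' y : 'rV[F]_3) : y != 0 -> x^T *m y = x'^T *m y -> x = x'.
Proof.
case/row_neq0 => j yj /matrixP e; apply/rowP => i.
by have := e i j; rewrite !tensorE => /(mulIf yj).
Qed.

Hypothesis T_inj : injective T.

Lemma dim_ruling2 (y : 'rV[F]_3) : y != 0 -> \dim (ruling2 T y) = 3%N.
Proof.
move=> y0; rewrite /ruling2 limg_dim_eq ?dimvf ?dim_matrix //.
have -> : lker (linfun (fun x : 'rV[F]_3 => T (x^T *m y))) = 0%VS; last by rewrite capv0.
apply/eqP/lker0P => x x'; rewrite !(lfunE (tensor_r y)).
by move=> /T_inj; apply: tensor_eq.
Qed.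

(** * Fixed points and planes when the eigenvectors of [h] are the tensors of [x] with [y a] *)

Variables (h : {linear 'rV[F]_9 -> 'rV[F]_9}) (y : F -> 'rV[F]_3).
Variable sigma : PGsub 'rV[F]_9 0 -> PGsub 'rV[F]_9 0.

Hypothesis y_neq0 : forall a, a ^+ 3 = 1 -> y a != 0.
Hypothesis eigenP : forall a (v : 'rV[F]_9), v != 0 ->
  h v = a *: v <-> a ^+ 3 = 1 /\ exists x, v = T (x^T *m y a).
Hypothesis h_sigma : forall (Q : PGsub 'rV[F]_9 0) v, v \in val Q -> h v \in val (sigma Q).

Let pt a (x : 'rV[F]_3) := T (x^T *m y a).

Let pt_neq0 a (x : 'rV[F]_3) : a ^+ 3 = 1 -> x != 0 -> pt a x != 0.
Proof.
move=> a3; apply: contraNneq; rewrite /pt -(linear0 T) => /T_inj.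
by rewrite -(mul0mx _ (y a)) -trmx0 => /(tensor_eq (y_neq0 a3)) ->.
Qed.

Let pt_eigen a x : a ^+ 3 = 1 -> h (pt a x) = a *: pt a x.
Proof.
move=> a3; case: (eqVneq (pt a x) 0) => [->|p0]; first by rewrite linear0 scaler0.
by apply/(eigenP a p0); split=> //; exists x.
Qed.

(** Since [h] maps the line [Q] into [sigma Q], fixing [Q] means that [v] is an eigenvector.
    Conversely [a ^+ 3 = 1] makes [a] nonzero, so [v] itself lies in [sigma Q]. *)
Let fixed_eigen (Q : PGsub 'rV[F]_9 0) (v : 'rV[F]_9) : v != 0 -> v \in val Q ->
  sigma Q = Q <-> exists a, h v = a *: v.
Proof.
move=> v0 vQ.
split=> [e|[a e]].
  have QV : val Q = <[v]>%VS.
    by apply/eqP; rewrite eq_sym eqEdim -memvE vQ (eqP (valP Q)) dim_vline v0.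
  by apply/vlineP; rewrite -QV -[Q in val Q]e h_sigma.
have [a3 _] := (eigenP a v0).1 e.
have a0 : a != 0 by apply: contra_eq_neq a3 => ->; rewrite expr0n /= eq_sym oner_eq0.
apply: (PG_point_eq v0) (vQ); have := h_sigma vQ.
by rewrite e rpredZeq (negPf a0).
Qed.

Let fixedP (Q : PGsub 'rV[F]_9 0) : sigma Q = Q <->
  exists a (x : 'rV[F]_3), [/\ a ^+ 3 = 1, x != 0 & val Q = <[pt a x]>%VS].
Proof.
split=> [|[a [x [a3 x0 QE]]]].
  have [v v0 QE] := PG_pointP Q; rewrite (fixed_eigen v0) ?QE ?memv_line //.
  case=> a /(eigenP a v0)[a3 [x vE]]; exists a, x; rewrite /pt -vE; split=> //.
  by apply: contraNneq v0 => x0; rewrite vE x0 trmx0 mul0mx linear0.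
by apply/(fixed_eigen (pt_neq0 a3 x0)); [rewrite QE memv_line | exists a; apply: pt_eigen].
Qed.

(** The eigenvalue of [h] recovers [a]; cancelling the common factor [y a] then recovers [x] up to a
    scalar. *)
Let pt_inj a b (x z : 'rV[F]_3) : a ^+ 3 = 1 -> b ^+ 3 = 1 -> x != 0 -> <[pt a x]>%VS = <[pt b z]>%VS ->
  a = b /\ exists k, x = k *: z.
Proof.
move=> a3 b3 x0 /vline_eq[k e]; have p0 := pt_neq0 a3 x0.
have ab : a = b.
  have := pt_eigen x a3; rewrite {1}e linearZ /= pt_eigen // scalerA mulrC -scalerA -e.
  move/eqP; rewrite -subr_eq0 -scalerBl scaler_eq0 (negPf p0) orbF subr_eq0.
  by move/eqP.
split=> //; exists k; move: e; rewrite -ab /pt -linearZ /= => /T_inj.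
by rewrite scalemxAl -linearZ /= => /(tensor_eq (y_neq0 a3)).
Qed.

Let g := gcdn 3 (#|F| - 1).

(** Fixed points correspond to pairs of a cube root of unity and a normalized triple. *)
Lemma card_fixed : has_card (fun Q : PGsub 'rV[F]_9 0 => sigma Q = Q) (g * (#|F| ^ 2 + #|F| + 1))%N.
Proof.
have [R [uR RP sR]] := cube_roots_of_unity F.
have [N [uN N0 sN Nall Ninj]] := point_representatives F.
have N_neq0 x : x \in N -> x != 0 by apply: contraTneq => ->.
rewrite /g -sR -sN -(size_allpairs pair).
apply: (has_card_PGsub (r := fun ax => <[pt ax.1 ax.2]>%VS)).
- by apply: allpairs_uniq => // -[? ?] [? ?].
- move=> _ _ /allpairsP[[a x] [/= aR xN ->]] /allpairsP[[b z] [/= bR zN ->]] /=.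
  rewrite !RP in aR bR.
  case/(pt_inj (eqP aR) (eqP bR) (N_neq0 _ xN)) => -> [k] /Ninj e.
  by rewrite e.
- move=> _ /allpairsP[[a x] [/= aR xN ->]] /=; rewrite RP in aR.
  by rewrite dim_vline pt_neq0 ?N_neq0 //; apply/eqP.
- move=> Q; rewrite fixedP; split=> [[a [x [a3 x0 QE]]]|[_ /allpairsP[[a x] [/= aR xN ->]] QE]].
    have [k [d [k0 dN xE]]] := Nall x x0.
    exists (a, d); first by apply: allpairs_f; rewrite ?RP ?a3.
    rewrite QE /= xE /pt linearZ -scalemxAl linearZ /=.
    apply/eqP; rewrite eqEdim -memvE memvZ ?memv_line //= !dim_vline.
    by rewrite scaler_eq0 (negPf k0).
  by exists a, x; split; rewrite ?N_neq0 //; apply/eqP; rewrite -RP.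
Qed.

Lemma card_fixed_ruling1 (x : 'rV[F]_3) : x != 0 ->
  has_card (fun Q : PGsub 'rV[F]_9 0 => (val Q <= ruling1 T x)%VS /\ sigma Q = Q) g.
Proof.
move=> x0; have [R [uR RP sR]] := cube_roots_of_unity F; rewrite /g -sR.
apply: (has_card_PGsub (r := fun a => <[pt a x]>%VS)) => //.
- move=> a b; rewrite !RP => /eqP a3 /eqP b3.
  by case/(pt_inj a3 b3 x0).
- by move=> a; rewrite RP => /eqP a3; rewrite dim_vline pt_neq0.
- move=> Q; split=> [[Qx /fixedP[a [z [a3 z0 QE]]]]|[a]].
    move: Qx; rewrite QE -memvE => /ruling1P[u /T_inj e]; exists a; first by rewrite RP a3.
    have [j yj] := row_neq0 (y_neq0 a3).
    (* Two equal pure tensors have proportional left factors; the ratio is read off in a column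
       where [y a] is nonzero. *)
    have zx : z = (u 0 j / y a 0 j) *: x.
      apply/rowP => i; apply: (mulIf yj); rewrite mxE -tensorE e tensorE.
      by rewrite mulrAC divfK // mulrC.
    have k0 : u 0 j / y a 0 j != 0.
      by apply: contraNneq z0 => k0; rewrite zx k0 scale0r.
    rewrite zx /pt linearZ -scalemxAl linearZ /=.
    apply/eqP; rewrite eqEdim -memvE memvZ ?memv_line //= !dim_vline.
    by rewrite scaler_eq0 (negPf k0).
  rewrite RP => /eqP a3 QE; split; last by apply/fixedP; exists a, x.
  by rewrite QE -memvE; apply/ruling1P; exists (y a).
Qed.

Lemma ptwise_fixedP (U : PGsub 'rV[F]_9 2) : ptwise_fixed sigma U <->
  exists2 a, a ^+ 3 = 1 & val U = ruling2 T (y a).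
Proof.
have dU := eqP (valP U); split=> [fixU|[a a3 UE] Q].
  have eig w : w \in val U -> exists a, h w = a *: w.
    case: (eqVneq w 0) => [->|w0 wU]; first by exists 0; rewrite linear0 scaler0.
    have d1 : \dim <[w]>%VS == 1%N by rewrite dim_vline w0.
    pose Q : PGsub 'rV[F]_9 0 := exist (fun W : {vspace 'rV[F]_9} => \dim W == 1%N) _ d1.
    apply/(@fixed_eigen Q w w0 (memv_line w)).
    by apply: fixU; rewrite -memvE.
  (* A single nonzero vector of [U] fixes the eigenvalue [a]. Every other [w] shares it, because
     [u + w] is an eigenvector too, so [U] lies in a ruling plane of the same dimension. *)
  have u0 : vpick (val U) != 0 by rewrite vpick0 -dimv_eq0 dU.
  have uU := memv_pick (val U).
  have [a hu] := eig _ uU; have [a3 _] := (eigenP a u0).1 hu.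
  exists a => //; apply/eqP; rewrite eqEdim dU dim_ruling2 ?y_neq0 // andbT.
  apply/subvP => w wU; apply/ruling2P.
  case: (eqVneq w 0) => [->|w0]; first by exists 0; rewrite trmx0 mul0mx linear0.
  have [b hw] := eig w wU; have [d hd] := eig _ (memvD uU wU).
  have ab := common_eigenvalue u0 w0 hu hw hd.
  by rewrite -ab in hw; case: ((eigenP a w0).1 hw).
have [v v0 QE] := PG_pointP Q; rewrite QE -memvE UE => /ruling2P[x vE].
apply/(fixed_eigen v0); first by rewrite QE memv_line.
by exists a; rewrite vE; apply: pt_eigen.
Qed.

Lemma card_ptwise_fixed : has_card (fun U : PGsub 'rV[F]_9 2 => ptwise_fixed sigma U) g.
Proof.
have [R [uR RP sR]] := cube_roots_of_unity F; rewrite /g -sR.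
apply: (has_card_PGsub (r := fun a => ruling2 T (y a))) => //.
- move=> a b; rewrite !RP => /eqP a3 /eqP b3 e.
  (* Any nonzero [x] serves as a test vector: if the planes of [a] and [b] coincide, its tensor with
     [y a] has both eigenvalues. *)
  have x0 : const_mx 1 != 0 :> 'rV[F]_3.
    by apply/eqP => /rowP/(_ 0); rewrite !mxE; apply/eqP/oner_neq0.
  have p0 := pt_neq0 a3 x0.
  have : pt a (const_mx 1) \in ruling2 T (y b).
    by rewrite -e; apply/ruling2P; exists (const_mx 1).
  case/ruling2P => z pE; have := pt_eigen z b3; rewrite /pt -pE -/(pt _ _) pt_eigen //.
  move/eqP; rewrite -subr_eq0 -scalerBl scaler_eq0 (negPf p0) orbF subr_eq0.
  by move/eqP.
- by move=> a; rewrite RP => /eqP a3; rewrite dim_ruling2 ?y_neq0.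
- move=> U; rewrite ptwise_fixedP.
  by split=> -[a a3 ->]; exists a => //; [rewrite RP a3 | apply/eqP; rewrite -RP].
Qed.

Lemma fixed_iff_in_ptwise_fixed (Q : PGsub 'rV[F]_9 0) : sigma Q = Q <->
  (exists2 U, ptwise_fixed sigma U & (val Q <= val U)%VS).
Proof.
split=> [/fixedP[a [x [a3 x0 QE]]]|[U fixU]]; last exact: fixU.
have d3 : \dim (ruling2 T (y a)) == 3%N by rewrite dim_ruling2 ?y_neq0.
exists (exist (fun W : {vspace 'rV[F]_9} => \dim W == 3%N) _ d3); first by apply/ptwise_fixedP; exists a.
by rewrite QE -memvE; apply/ruling2P; exists x.
Qed.

End Tensors.

(** * Semilinear maps fixing a subplane pointwise *)

Lemma idem_addr_eq0 (V : zmodType) (x : V) : x = x + x -> x = 0.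
Proof. by move=> e; apply: (addrI x); rewrite addr0. Qed.

Lemma row_mulmx_inj (R : comUnitRingType) n (B : 'M[R]_n) (u v : 'rV[R]_n) :
  B \in unitmx -> u *m B = v *m B -> u = v.
Proof. by move=> BU e; rewrite -[u](mulmxK BU) e mulmxK. Qed.

(** This is the frame argument: the unit vectors and the all-one vector are eigenvectors, which
    forces one common multiplier [l]. The size [n.+2] provides the two coordinates that detect the
    action of [tau] on [F]. *)
Lemma semilinear_fixing_subplane (F : fieldType) (L : fieldExtType F) (n : nat)
    (tau : {rmorphism L -> L}) (f : 'rV[L]_n.+2 -> 'rV[L]_n.+2) :
  (forall a u v, f (a *: u + v) = tau a *: f u + f v) ->
  (forall c : 'rV[F]_n.+2,
     exists l, f (map_mx (in_alg L) c) = l *: map_mx (in_alg L) c) ->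
  exists l, (forall v, f v = l *: map_mx tau v) /\
    (l != 0 -> forall a : F, tau a%:A = a%:A).
Proof.
move=> fP fix_f.
have f0 : f 0 = 0.
  by have := fP 1 0 0; rewrite scaler0 addr0 rmorph1 scale1r => /idem_addr_eq0.
have fZ a u : f (a *: u) = tau a *: f u by have := fP a u 0; rewrite f0 !addr0.
have fD u v : f (u + v) = f u + f v by have := fP 1 u v; rewrite rmorph1 !scale1r.
have fS (k : 'I_n.+2 -> L) : f (\sum_i k i *: delta_mx 0 i) =
    \sum_i tau (k i) *: f (delta_mx 0 i).
  rewrite (big_morph f fD f0); apply: eq_bigr => i _; exact: fZ.
have [l fl] := fix_f (const_mx 1).
have fdelta i : f (delta_mx 0 i) = l *: delta_mx 0 i.
  have d j : exists m, f (delta_mx 0 j) = m *: delta_mx 0 j.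
    by have := fix_f (delta_mx 0 j); rewrite map_delta_mx.
  have [m mP] := fin_all_exists d.
  have := fl; rewrite map_const_mx rmorph1 [X in f X]row_sum_delta fS.
  move=> /rowP/(_ i); rewrite !mxE summxE (bigD1 i) //= big1 => [|j ji].
    by rewrite mP !mxE !eqxx rmorph1 mul1r !mulr1 addr0  => ->.
  by rewrite mP !mxE eqxx [i == j]eq_sym (negPf ji) !mulr0.
exists l; split=> [v|l0 a].
  rewrite [v in LHS]row_sum_delta fS [map_mx tau v]row_sum_delta scaler_sumr.
  by apply: eq_bigr => i _; rewrite fdelta !scalerA mulrC mxE.
(* Coordinate 0 gives [m = l], and coordinate 1 then gives [l * tau a = l * a]. *)
have [m] := fix_f (delta_mx 0 0 + a *: delta_mx 0 1).
rewrite map_mxD map_mxZ !map_delta_mx fD fZ !fdelta => /rowP e.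
have := e 0; have := e 1; rewrite !mxE /= !(mulr0, mulr1, addr0, add0r) => + ml.
by rewrite -ml mulrC => /(mulfI l0).
Qed.

(** * Eigenvectors with eigenvalue in the ground field *)

Section Semilinear.

Variables (F : finFieldType) (L : fieldExtType F).
Variables (tau : {rmorphism L -> L}) (l : L) (f : 'rV[L]_3 -> 'rV[L]_3) (B : 'M[L]_3).
Hypotheses (dimL : \dim {:L} = 3%N) (BU : B \in unitmx) (l_neq0 : l != 0).
Hypotheses (tauF : forall a : F, tau a%:A = a%:A) (tau_neq : exists x, tau x != x).
Hypotheses (fE : forall v, f (v *m B) = l *: (map_mx tau v *m B)).
Hypotheses (f3 : forall v, f (f (f v)) = v).

(** In coordinates, the cube of [f] is [tau^3] on entries followed by multiplication by the norm of
    [l]. Constant vectors separate the two factors, with entry 1 giving the norm. *)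
Lemma semilinear_order3 : (forall x, tau (tau (tau x)) = x) /\ l * tau l * tau (tau l) = 1.
Proof.
have f3E (v : 'rV[L]_3) : l * tau l * tau (tau l) *: map_mx tau (map_mx tau (map_mx tau v)) = v.
  apply: (row_mulmx_inj BU); rewrite -[RHS]f3 fE.
  by rewrite scalemxAl fE map_mxZ scalemxAl fE !map_mxZ scalemxAl !scalerA.
have e x : l * tau l * tau (tau l) * tau (tau (tau x)) = x.
  by have /rowP/(_ 0) := f3E (const_mx x); rewrite !mxE.
have N : l * tau l * tau (tau l) = 1 by have := e 1; rewrite !rmorph1 mulr1.
by split=> // x; have := e x; rewrite N mul1r.
Qed.

Lemma semilinear_eigenvectors : exists rho : F -> L,
  (forall a, a ^+ 3 = 1 -> rho a != 0) /\
  forall a v, v != 0 -> f v = a%:A *: v <->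
    a ^+ 3 = 1 /\ exists c, v = rho a *: (map_mx (in_alg L) c *m B).
Proof.
have [tau3 Nl] := semilinear_order3.
have H (a : F) : exists r, a ^+ 3 = 1 -> r != 0 /\ l * tau r = a%:A * r.
  (* The value 0 is a default where [a] is not a cube root of unity. *)
  case: (eqVneq (a ^+ 3) 1) => [a3|na3]; last by exists 0 => a3; rewrite a3 eqxx in na3.
  have a0 : a != 0 by apply: contra_eq_neq a3 => ->; rewrite expr0n /= eq_sym oner_eq0.
  have aA : a%:A * a^-1%:A = 1 :> L.
    by rewrite -(rmorphM (in_alg L)) /= divff // scale1r.
  (* Hilbert 90 is applied to [l / a], whose norm is that of [l] divided by [a ^+ 3]. *)
  have Nc : let c := l * a^-1%:A in c * tau c * tau (tau c) = 1.
    rewrite /= !rmorphM !tauF.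
    have -> : l * a^-1%:A * (tau l * a^-1%:A) * (tau (tau l) * a^-1%:A) =
      (l * tau l * tau (tau l)) * (a^-1%:A ^+ 3) by ring.
    by rewrite Nl mul1r -(rmorphXn (in_alg L)) /= exprVn a3 invr1 scale1r.
  have [r r0 e] := hilbert90_order3 tau3 tau_neq Nc.
  exists r => _; split=> //; rewrite -[in RHS]e.
  have -> : a%:A * (l * a^-1%:A * tau r) = (a%:A * a^-1%:A) * (l * tau r) by ring.
  by rewrite aA mul1r.
have [rho rhoP] := fin_all_exists H.
exists rho; split=> [a /rhoP[]//|a v v0].
have [w vE] : exists w, v = w *m B by exists (v *m invmx B); rewrite mulmxKV.
split=> [e|[a3 [c ->]]]; last first.
  have [_ re] := rhoP a a3.
  rewrite scalemxAl fE map_mxZ -!scalemxAl !scalerA re; congr (_ *: (_ *m _)).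
  by apply/rowP => i; rewrite !mxE /= tauF.
have a3 : a ^+ 3 = 1.
  have fZ k u : f (k%:A *: u) = k%:A *: f u.
    rewrite -[u](mulmxKV BU) scalemxAl fE map_mxZ /= tauF fE -scalemxAl !scalerA.
    by rewrite mulrC.
  have := f3 v; rewrite e !fZ e fZ e !scalerA.
  move=> /eqP; rewrite -{2}[v]scale1r -subr_eq0 -scalerBl scaler_eq0 (negPf v0) orbF.
  rewrite subr_eq0 => /eqP aaa; apply: (fmorph_inj (in_alg L)).
  by rewrite rmorph1 rmorphXn /= !exprS expr0 mulr1 mulrA.
split=> //; have [r0 re] := rhoP a a3.
have wE : l *: map_mx tau w = a%:A *: w.
  apply: (row_mulmx_inj BU); rewrite -scalemxAl -fE -vE e.
  by rewrite -scalemxAl -vE.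
(* Both [w] and [rho a] satisfy [l * tau x = a * x], so their quotients are fixed by [tau] and lie
   in [F]. *)
have d i : exists k : F, w 0 i / rho a = k%:A.
  apply: (fixed_in_alg dimL tauF tau_neq).
  rewrite fmorph_div; have /rowP/(_ i) := wE; rewrite !mxE => wi.
  have tr0 : tau (rho a) != 0 by rewrite fmorph_eq0.
  apply/eqP; rewrite eqr_div //; apply/eqP/(mulfI l_neq0).
  by rewrite mulrA wi [in RHS]mulrCA re; ring.
have [k kP] := fin_all_exists d.
exists (\row_i k i); rewrite scalemxAl {1}vE; congr (_ *m _).
by apply/rowP => i; rewrite !mxE /= -kP mulrC divfK.
Qed.

End Semilinear.

(** * The Bose representation in tensor coordinates *)

Section BoseTensors.

Variables (F : finFieldType) (L : fieldExtType F) (iota : 'rV[F]_9 -> 'rV[L]_3).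
Variable (B : 'M[L]_3).
Hypotheses (dimL : \dim {:L} = 3%N) (BU : B \in unitmx) (hiota : identification iota).

Lemma bose_tensors : exists (T : {linear 'M[F]_3 -> 'rV[F]_9}) (en : 'rV[F]_3 -> L),
  [/\ bijective T, bijective en, en 0 = 0
    & forall x y, iota (T (x^T *m y)) = en y *: (map_mx (in_alg L) x *m B)].
Proof.
case: hiota => -[kappa iK kK] iP.
have [e eB] : exists e : 3.-tuple L, basis_of {:L} e.
  by rewrite -dimL; exists (vbasis _); apply: vbasisP.
pose en (y : 'rV[F]_3) : L := \sum_j y 0 j *: e`_j.
pose de (z : L) : 'rV[F]_3 := \row_j coord e j z.
have enK : cancel en de.
  move=> y; apply/rowP => j; rewrite mxE coord_sum_free //; exact: basis_free eB.
have deK : cancel de en.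
  move=> z; rewrite [RHS](coord_basis eB (memvf z)).
  by apply: eq_bigr => j _; rewrite mxE.
have enP k y z : en (k *: y + z) = k *: en y + en z.
  rewrite /en scaler_sumr -big_split; apply: eq_bigr => j _ /=.
  by rewrite !mxE scalerDl scalerA.
(* Row [i] of [M], read in [L] through the basis [e], becomes coordinate [i] relative to [B]; a pure
   tensor thus becomes a scalar of [L] times a subplane vector. *)
pose T0 (M : 'M[F]_3) : 'rV[F]_9 := kappa ((\row_i en (row i M)) *m B).
have lin : linear T0.
  move=> k M N; apply: (can_inj iK); rewrite iP !kK scalemxAl -mulmxDl.
  congr (_ *m _); apply/rowP => i; rewrite !mxE linearP enP.
  by rewrite /= mulr_algl.
pose T : {linear 'M[F]_3 -> 'rV[F]_9} :=
  HB.pack T0 (GRing.isLinear.Build F 'M[F]_3 'rV[F]_9 _ T0 lin).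
exists T, en; split.
- exists (fun v => \matrix_i de ((iota v *m invmx B) 0 i)) => [M|v].
    apply/row_matrixP => i; rewrite rowK /= kK mulmxK // mxE.
    exact: enK.
  apply: (can_inj iK); rewrite /= kK -[RHS](mulmxKV BU); congr (_ *m _).
  by apply/rowP => i; rewrite mxE rowK deK.
- by exists de.
- by rewrite /en big1 // => j _; rewrite mxE scale0r.
- move=> x y; rewrite /= kK scalemxAl; congr (_ *m _); apply/rowP => i.
  rewrite !mxE /= /en mulr_algr scaler_sumr; apply: eq_bigr => j _.
  by rewrite mxE tensorE scalerA.
Qed.

Lemma memv_bose P v : (v \in bose iota P) = (iota v \in val P).
Proof.
case: hiota => _ iP.
have i0 : iota 0 = 0.
  by have := iP 1 0 0; rewrite scaler0 addr0 !scale1r => /idem_addr_eq0.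
apply/idP/idP => [|vP]; last by apply: memv_span; rewrite mem_enum.
move/coord_span => ->; apply: (big_ind (fun u => iota u \in val P)).
- by rewrite i0 mem0v.
- by move=> u w uP wP; rewrite -[u]scale1r iP scale1r scale1r memvD.
- move=> i _; rewrite -[X in iota X]addr0 iP i0 addr0 memvZ //.
  have := @mem_nth _ 0 (enum [pred u | iota u \in val P]) i.
  by rewrite -cardE ltn_ord mem_enum; apply.
Qed.

(** As [en] is onto [L], letting [y] vary for fixed [x] produces all [L]-multiples of the vector
    spanning [P]. *)
Lemma bose_ruling1 (T : {linear 'M[F]_3 -> 'rV[F]_9}) (en : 'rV[F]_3 -> L) P x :
  bijective en ->
  (forall x y, iota (T (x^T *m y)) = en y *: (map_mx (in_alg L) x *m B)) ->
  val P = <[map_mx (in_alg L) x *m B]>%VS -> bose iota P = ruling1 T x.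
Proof.
move=> [de enK deK] TP PE; apply/vspaceP => v; rewrite memv_bose PE.
apply/vlineP/ruling1P => [[k e]|[y ->]]; last by exists (en y).
exists (de k); apply: (bij_inj hiota.1); by rewrite TP deK.
Qed.

End BoseTensors.

(** * From the collineation to the tensor model *)

Theorem theorem1 (q : nat) (F : finFieldType) (L : fieldExtType F)
    (hF : #|F| = q) (hq : (2 < q)%N) (hL : \dim {: L} = 3%N)
    (S : PGsub 'rV[L]_3 0 -> Prop) (hS : subplane S)
    (phi : PGsub 'rV[L]_3 0 -> PGsub 'rV[L]_3 0)
    (phi_coll : collineation phi) (phi_order3 : order3 phi)
    (phi_fix : forall P, S P -> phi P = P)
    (f : 'rV[L]_3 -> 'rV[L]_3) (f_semilinear : semilinear_map f)
    (f_order3 : order3 f) (f_phi : defines f phi)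
    (iota : 'rV[F]_9 -> 'rV[L]_3) (hiota : identification iota)
    (sigma : PGsub 'rV[F]_9 0 -> PGsub 'rV[F]_9 0)
    (f_sigma : induces iota f sigma) :
  let g := gcdn 3 (q - 1) in
  [/\ has_card (fun Q : PGsub 'rV[F]_9 0 => sigma Q = Q) (g * (q ^ 2 + q + 1))%N,
      forall P, S P ->
        has_card (fun Q : PGsub 'rV[F]_9 0 =>
          (val Q <= bose iota P)%VS /\ sigma Q = Q) g
    & [/\ has_card (fun U : PGsub 'rV[F]_9 2 => ptwise_fixed sigma U) g,
          forall Q, sigma Q = Q <->
            (exists2 U, ptwise_fixed sigma U & (val Q <= val U)%VS)
        & forall U, ptwise_fixed sigma U ->
            subplane_ruling_plane iota S (val U)]].
Proof.
case: hS => B BU SP; case: f_semilinear => tau fP; case: f_order3 => f3 _.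
have nz (c : 'rV[F]_3) : c != 0 -> map_mx (in_alg L) c *m B != 0.
  apply: contraNneq => e; have : map_mx (in_alg L) c = 0.
    by rewrite -[LHS](mulmxK BU) e mul0mx.
  by move/eqP; rewrite map_mx_eq0.
have f0 : f 0 = 0.
  by have := fP 1 0 0; rewrite scaler0 addr0 rmorph1 scale1r => /idem_addr_eq0.
have mkpt (v : 'rV[L]_3) : v != 0 -> exists P : PGsub 'rV[L]_3 0, val P = <[v]>%VS.
  move=> v0; have d : \dim <[v]>%VS == 1%N by rewrite dim_vline v0.
  by exists (exist (fun W : {vspace 'rV[L]_3} => \dim W == 1%N) _ d).
(* In the coordinates of [B], the map has every vector over [F] as an eigenvector, because [phi]
   fixes the subplane pointwise. *)
have [l [flB l_tau]] : exists l, (forall v, f (v *m B) *m invmx B = l *: map_mx tau v) /\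
    (l != 0 -> forall a : F, tau a%:A = a%:A).
  apply: semilinear_fixing_subplane => [a u v|c].
    by rewrite mulmxDl -scalemxAl fP mulmxDl -scalemxAl.
  case: (eqVneq c 0) => [->|c0]; first by exists 0; rewrite map_mx0 mul0mx f0 mul0mx scaler0.
  have [P PE] := mkpt _ (nz c c0).
  have SPP : S P by apply/SP; exists c.
  have := f_phi P (map_mx (in_alg L) c *m B); rewrite phi_fix // PE memv_line.
  by case/(_ isT)/vlineP => k ->; exists k; rewrite -scalemxAl mulmxK.
have fE v : f (v *m B) = l *: (map_mx tau v *m B).
  by rewrite scalemxAl -flB mulmxKV.
(* Otherwise [f] would vanish everywhere, contradicting that its cube is the identity. *)
have l0 : l != 0.
  apply/eqP => l0; have /eqP := f3 (const_mx 1 *m B).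
  have n1 : const_mx 1 != 0 :> 'rV[F]_3.
    by apply/eqP => /rowP/(_ 0); rewrite !mxE; apply/eqP/oner_neq0.
  have := nz _ n1; rewrite map_const_mx rmorph1 fE l0 scale0r !f0 eq_sym.
  by move=> /negPf ->.
have tauF := l_tau l0.
(* If [tau] fixed all coordinates of a vector spanning a point moved by [phi], that vector would be
   an eigenvector of [f] and the point would be fixed. *)
have tau_neq : exists x, tau x != x.
  case: phi_order3 => _ [P phiP]; have [v v0 PE] := PG_pointP P.
  pose w := v *m invmx B.
  have /existsP[i wi] : [exists i, tau (w 0 i) != w 0 i]; last by exists (w 0 i).
  apply: contra_notT phiP => /existsPn fixw.
  have fv : f v = l *: v.
    rewrite -[v](mulmxKV BU) fE -/w; congr (_ *: (_ *m _)).
    by apply/rowP => i; rewrite mxE; apply/eqP; have := fixw i; rewrite negbK.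
  have vP : v \in val P by rewrite PE memv_line.
  have := f_phi P v vP; rewrite fv rpredZeq (negPf l0) /= => vphi.
  exact: PG_point_eq v0 vphi vP.
have [rho [rho0 rhoP]] := semilinear_eigenvectors hL BU l0 tauF tau_neq fE f3.
have [T [en [Tb enb en0 TP]]] := bose_tensors hL BU hiota.
have [[kappa iK kK] iP] := hiota.
have [de enK deK] := enb.
pose h0 v := kappa (f (iota v)).
(* The map [f] becomes linear over [F] because [tau] fixes [F]. *)
have lin : linear h0.
  move=> k u v; apply: (can_inj iK); rewrite iP !kK iP fP.
  by rewrite /= tauF.
pose h : {linear 'rV[F]_9 -> 'rV[F]_9} :=
  HB.pack h0 (GRing.isLinear.Build F 'rV[F]_9 'rV[F]_9 _ h0 lin).
have i0 : iota 0 = 0.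
  by have := iP 1 0 0; rewrite scaler0 addr0 !scale1r => /idem_addr_eq0.
have iZ k v : iota (k *: v) = k%:A *: iota v.
  by rewrite -[X in iota X]addr0 iP i0 addr0.
pose y a := de (rho a).
have y0 a : a ^+ 3 = 1 -> y a != 0.
  by move=> /rho0; apply: contraNneq => e; rewrite -(deK (rho a)) -/(y a) e en0.
have eigP a (v : 'rV[F]_9) : v != 0 -> h v = a *: v <-> a ^+ 3 = 1 /\ exists x, v = T (x^T *m y a).
  move=> v0; have iv0 : iota v != 0.
    by apply: contraNneq v0 => e; rewrite -(iK v) e -i0 iK.
  have := rhoP a _ iv0; rewrite -iZ => fvP.
  split=> [e|[a3 [x e]]].
    have /fvP[a3 [x xE]] : f (iota v) = iota (a *: v) by rewrite -e /= kK.
    split=> //; exists x; apply: (can_inj iK); by rewrite TP xE deK.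
  apply: (can_inj iK); rewrite /= kK; apply/fvP; split=> //; exists x.
  by rewrite e TP deK.
have hs (Q : PGsub 'rV[F]_9 0) v : v \in val Q -> h v \in val (sigma Q).
  by move=> vQ; apply: (f_sigma Q v) => //=; rewrite kK.
have Ti := bij_inj Tb.
move=> g; rewrite /g -hF; split.
- exact (card_fixed Ti y0 eigP hs).
- move=> P /SP[c c0 PE]; rewrite (bose_ruling1 hiota enb TP PE).
  exact (card_fixed_ruling1 Ti y0 eigP hs c0).
- split.
  + exact (card_ptwise_fixed Ti y0 eigP hs).
  + exact (fixed_iff_in_ptwise_fixed Ti y0 eigP hs).
  (* One [T] serves every [U]: its first ruling consists of the planes of the subplane points, and
     [U] is the member of the second ruling at [y a]. *)
  + move=> U /(ptwise_fixedP Ti y0 eigP hs)[a a3 UE]; exists T; split=> //.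
      move=> W; split=> [[x x0 ->]|[P /SP[x x0 PE] ->]].
        have [P PE] := mkpt _ (nz x x0); exists P; first by apply/SP; exists x.
        by rewrite (bose_ruling1 hiota enb TP PE).
      by exists x => //; rewrite (bose_ruling1 hiota enb TP PE).
    by exists (y a) => //; apply: y0.
Qed.
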